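(* Suppose a randomized learning algorithm $A$ is $\beta$-pointwise hypothesis stable with respect to an $M$-bounded loss $\ell$ and a fixed prior $P$ on $\Theta$. Then for any $n\ge1$ and $\delta\in(0,1)$, with probability at least $1-\delta$ over draws of $S\sim\mathcal{D}^n$, every posterior $Q$ on $\Theta$ satisfies $$\Phi(S,Q)\le\sqrt{\Big(\frac{\chi^2(Q\|P)+1}{\delta}\Big)\Big(\frac{2M^2}{n}+12M\beta\Big)},$$ where $\chi^2(Q\|P)=\mathbb{E}_{\theta\sim P}\big[(Q(\theta)/P(\theta))^2-1\big]$.
   Context: Setting: $\mathcal{Z}=\mathcal{X}\times\mathcal{Y}$ with unknown distribution $\mathcal{D}$; $S=(z_1,\dots,z_n)$ i.i.d. from $\mathcal{D}$; $A:\mathcal{Z}^n\times\Theta\to\mathcal{H}$ deterministic with hyperparameters $\theta\in\Theta$; $\ell:\mathcal{H}\times\mathcal{Z}\to[0,M]$. Risk $R(S,\theta)=\mathbb{E}_{z\sim\mathcal{D}}\ell(A(S,\theta),z)$, empirical risk $\hat R(S,\theta)=\frac1n\sum_i\ell(A(S,\theta),z_i)$, $\Phi(S,\theta)=R(S,\theta)-\hat R(S,\theta)$, and for a distribution $Q$ on $\Theta$, $\Phi(S,Q)=\mathbb{E}_{\theta\sim Q}\Phi(S,\theta)$. Posteriors $Q$ may depend on $S$; $Q(\theta)/P(\theta)$ denotes the density ratio (the $\chi^2$ divergence is $+\infty$ if $Q$ is not absolutely continuous w.r.t. $P$). $\beta$-pointwise hypothesis stability w.r.t. $\ell$ and $P$: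 with $S^{i,z}$ denoting $S$ with the $i$-th example replaced by $z$, $\sup_{i\in\{1,\dots,n\}}\mathbb{E}_{S\sim\mathcal{D}^n}\mathbb{E}_{z\sim\mathcal{D}}\mathbb{E}_{\theta\sim P}\big[|\ell(A(S,\theta),z_i)-\ell(A(S^{i,z},\theta),z_i)|\big]\le\beta$. *)

(* Defs.v *)
From HB Require Import structures.
From mathcomp Require Import all_boot all_order all_algebra.
From mathcomp Require Import all_classical all_reals all_analysis.
Set Implicit Arguments. Unset Strict Implicit. Unset Printing Implicit Defensive.
Import Order.TTheory GRing.Theory Num.Theory.
Local Open Scope classical_set_scope.
Local Open Scope ring_scope.

Section pac_defs.
Context {dZ : measure_display} {R : realType} {Z : measurableType dZ}.

(* E_{S ~ D^n} [f S] for a sample S = (z_1,...,z_n) : n.-tuple Z, realised as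
   the iterated integral  \int[D]_{z_1} ... \int[D]_{z_n} f (z_1,...,z_n),
   which (Tonelli) is the integral w.r.t. the n-fold product D^n for
   nonnegative measurable f. *)
Fixpoint sample_int (D : probability Z R) (n : nat) :
    (n.-tuple Z -> \bar R) -> \bar R :=
  match n return (n.-tuple Z -> \bar R) -> \bar R with
  | 0 => fun f => f [tuple]
  | n'.+1 => fun f =>
      (\int[D]_z sample_int D (fun s : n'.-tuple Z => f (cons_tuple z s)))%E
  end.

Definition sample_prob (D : probability Z R) (n : nat) (E : set (n.-tuple Z))
  : \bar R := sample_int D (fun S => (\1_E S)%:E).

Definition replace_at (n : nat) (S : n.-tuple Z) (i : 'I_n) (z : Z)
  : n.-tuple Z := [tuple (if j == i then z else tnth S j) | j < n].

Context {dT : measure_display} {Theta : measurableType dT} {H : Type}.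

Definition risk (D : probability Z R) (loss : H -> Z -> R) (n : nat)
  (A : n.-tuple Z -> Theta -> H) (S : n.-tuple Z) (theta : Theta) : \bar R :=
  (\int[D]_z (loss (A S theta) z)%:E)%E.

Definition emp_risk (loss : H -> Z -> R) (n : nat)
  (A : n.-tuple Z -> Theta -> H) (S : n.-tuple Z) (theta : Theta) : R :=
  n%:R^-1 * \sum_(i < n) loss (A S theta) (tnth S i).

Definition gen_gap (D : probability Z R) (loss : H -> Z -> R) (n : nat)
  (A : n.-tuple Z -> Theta -> H) (S : n.-tuple Z) (theta : Theta) : \bar R :=
  (risk D loss A S theta - (emp_risk loss A S theta)%:E)%E.

Definition gen_gap_post (D : probability Z R) (loss : H -> Z -> R) (n : nat)
  (A : n.-tuple Z -> Theta -> H) (S : n.-tuple Z) (Q : probability Theta R)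
  : \bar R :=
  (\int[Q]_theta gen_gap D loss A S theta)%E.

Definition pointwise_hyp_stable (D : probability Z R) (P : probability Theta R)
  (loss : H -> Z -> R) (n : nat) (A : n.-tuple Z -> Theta -> H) (beta : R)
  : Prop :=
  forall i : 'I_n,
    (sample_int D (fun S =>
       \int[D]_z \int[P]_theta
          `| (loss (A S theta) (tnth S i)
              - loss (A (replace_at S i z) theta) (tnth S i))%:E |)
     <= beta%:E)%E.

End pac_defs.

Definition chi2 {dT : measure_display} {R : realType} {Theta : measurableType dT}
  (Q P : probability Theta R) : \bar R :=
  if pselect (Q `<< P) then
    (\int[P]_theta (((Radon_Nikodym (charge_of_finite_measure Q) P) theta) ^+ 2 - 1))%E
  else +oo%E.

(* Main.v *)
(** The second moment of the gap is bounded first: with fresh test examples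
    z, z', and l the loss, E Phi^2 is the mean over i of
    E[(l(S,z) - l(S,z_i)) (l(S,z') - Remp(S))]. Replacing the i-th example of S
    by a fresh one makes z_i independent of the sample, so that the expectation
    becomes 0; by stability the replacement changes the loss at a fresh point by
    at most 2 beta, at z_i by beta and at another training point z_j by 4 beta,
    in mean. This yields E Phi^2 <= M^2/n + 9 M beta. By Markov's inequality,
    E_{theta ~ P} Phi(S,theta)^2 is then at most 1/delta times that bound outside
    an event of probability delta, and the Cauchy-Schwarz inequality applied to
    Phi(S,Q) = E_P[Phi dQ/dP] gives the bound for all Q simultaneously. *)

Require Import Defs.
From HB Require Import structures.
From mathcomp Require Import all_boot all_order all_algebra.
From mathcomp Require Import all_classical all_reals all_analysis.
From mathcomp Require Import measurable_realfun ring lra.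
Import Order.TTheory GRing.Theory Num.Theory.
Local Open Scope classical_set_scope.
Local Open Scope ring_scope.

(** * Measure-preserving maps and the law of a sample *)

Section probability_product.
Context {R : realType} {d1 d2 : measure_display}.
Context {T1 : measurableType d1} {T2 : measurableType d2}.
Variables (m1 : probability T1 R) (m2 : probability T2 R).
Local Open Scope ereal_scope.

(** The annotation keeps the product a [probability], so that products nest and every factor has
    mass 1. *)
Definition pprod : probability (T1 * T2)%type R := (m1 \x m2).

Variable f : (T1 * T2)%type -> \bar R.
Hypothesis mf : measurable_fun [set: (T1 * T2)%type] f.
Hypothesis f0 : forall x, 0 <= f x.

Lemma pprod_tonelli1 : \int[pprod]_x f x = \int[m1]_x \int[m2]_y f (x, y).
Proof. exact: fubini_tonelli1. Qed.

Lemma pprod_tonelli2 : \int[pprod]_x f x = \int[m2]_y \int[m1]_x f (x, y).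
Proof. exact: fubini_tonelli2. Qed.

Lemma measurable_pprod_tonelli :
  measurable_fun [set: T1] (fun x => \int[m2]_y f (x, y)).
Proof. exact: measurable_fun_fubini_tonelli_F. Qed.

End probability_product.

Arguments pprod : simpl never.

Section measure_preserving.
Context {R : realType}.
Local Open Scope ereal_scope.

Section mpres_def.
Context {d1 d2 : measure_display}.
Context {T1 : measurableType d1} {T2 : measurableType d2}.

(** Invariance is tested on integrals of nonnegative functions rather than on preimages: Tonelli
    then proves it directly, and such maps compose. *)
Definition mpres (mu : probability T1 R) (nu : probability T2 R)
    (phi : T1 -> T2) :=
  measurable_fun [set: T1] phi /\
  forall f : T2 -> \bar R, measurable_fun [set: T2] f -> (forall y, 0 <= f y) ->
    \int[mu]_x f (phi x) = \int[nu]_y f y.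

(** The positive and negative parts are nonnegative, so [mpres] applies to each; the extended
    integrals agree before [fine] is taken. *)
Lemma mpres_Rintegral (mu : probability T1 R) (nu : probability T2 R)
    (phi : T1 -> T2) (f : T2 -> R) :
  mpres mu nu phi -> measurable_fun [set: T2] f ->
  (\int[mu]_x f (phi x) = \int[nu]_y f y)%R.
Proof.
move=> [mphi phiE] mf; congr fine; rewrite [LHS]integralE [RHS]integralE.
have mF : measurable_fun [set: T2] (EFin \o f) by exact/measurable_EFinP.
rewrite -(phiE ((EFin \o f)^\+))//; last exact: measurable_funepos.
rewrite -(phiE ((EFin \o f)^\-))//; last exact: measurable_funeneg.
by congr (_ - _); apply: eq_integral => x _; rewrite !unlock.
Qed.

End mpres_def.

Section mpres_marginals.
Context {d1 d2 : measure_display}.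
Context {T1 : measurableType d1} {T2 : measurableType d2}.

Lemma mpres_swap (m1 : probability T1 R) (m2 : probability T2 R) :
  mpres (pprod m1 m2) (pprod m2 m1) (fun x => (x.2, x.1)).
Proof.
have ms : measurable_fun [set: (T1 * T2)%type] (fun x => (x.2, x.1)).
  exact: measurable_fun_pair.
split=> // f mf f0; rewrite [RHS]pprod_tonelli1// pprod_tonelli2//.
exact: measurableT_comp mf ms.
Qed.

Lemma mpres_fst (m1 : probability T1 R) (m2 : probability T2 R) :
  mpres (pprod m1 m2) m1 fst.
Proof.
split=> // f mf f0; rewrite pprod_tonelli1//; last exact: measurableT_comp.
apply: eq_integral => x _; rewrite /= [LHS](integral_cst m2 measurableT (f x)).
by rewrite [X in _ * X](@probability_setT _ _ _ m2) mule1.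
Qed.

End mpres_marginals.

Lemma mpres_comp {d1 d2 d3} {T1 : measurableType d1} {T2 : measurableType d2}
    {T3 : measurableType d3} {mu : probability T1 R} {nu : probability T2 R}
    {la : probability T3 R} {phi : T1 -> T2} {psi : T2 -> T3} :
  mpres mu nu phi -> mpres nu la psi -> mpres mu la (psi \o phi).
Proof.
move=> [mphi phiE] [mpsi psiE]; split; first exact: measurableT_comp.
move=> f mf f0; rewrite -psiE// -(phiE (f \o psi))//; last first.
  by move=> y; exact: f0.
exact: measurableT_comp.
Qed.

Lemma mpres_snd {d1 d2} {T1 : measurableType d1} {T2 : measurableType d2}
    (m1 : probability T1 R) (m2 : probability T2 R) :
  mpres (pprod m1 m2) m2 snd.
Proof. exact: (mpres_comp (mpres_swap m1 m2) (mpres_fst m2 m1)). Qed.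

Lemma mpres_idX {d1 d2 d3} {T1 : measurableType d1} {T2 : measurableType d2}
    {T3 : measurableType d3} (m1 : probability T1 R) (m2 : probability T2 R)
    (m3 : probability T3 R) (phi : T2 -> T3) : mpres m2 m3 phi ->
  mpres (pprod m1 m2) (pprod m1 m3) (fun x => (x.1, phi x.2)).
Proof.
move=> [mphi phiE].
have mp : measurable_fun [set: (T1 * T2)%type] (fun x => (x.1, phi x.2)).
  by apply: measurable_fun_pair => //; exact: measurableT_comp.
split=> // f mf f0; rewrite pprod_tonelli1//; last exact: measurableT_comp mf mp.
rewrite pprod_tonelli1//; apply: eq_integral => x _.
by rewrite (phiE (fun y => f (x, y)))//; exact: measurableT_comp.
Qed.

Section mpres_associativity.
Context {d1 d2 d3 : measure_display} {T1 : measurableType d1}.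
Context {T2 : measurableType d2} {T3 : measurableType d3}.

Lemma mpres_Xid (m1 : probability T1 R) (m2 : probability T2 R)
    (m3 : probability T3 R) (phi : T2 -> T3) : mpres m2 m3 phi ->
  mpres (pprod m2 m1) (pprod m3 m1) (fun x => (phi x.1, x.2)).
Proof.
move=> h; exact: (mpres_comp (mpres_swap m2 m1)
  (mpres_comp (mpres_idX m1 _ _ _ h) (mpres_swap m1 m3))).
Qed.

Variables (m1 : probability T1 R) (m2 : probability T2 R).
Variable m3 : probability T3 R.

Lemma mpres_assoc : mpres (pprod (pprod m1 m2) m3) (pprod m1 (pprod m2 m3))
  (fun x => (x.1.1, (x.1.2, x.2))).
Proof.
have ma : measurable_fun [set: ((T1 * T2) * T3)%type]
    (fun x => (x.1.1, (x.1.2, x.2))).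
  by do 2 (apply: measurable_fun_pair => //; try exact: measurableT_comp).
split=> // f mf f0; have mfa := measurableT_comp mf ma.
rewrite pprod_tonelli1//= pprod_tonelli1//=; last 2 first.
- by apply: (measurable_pprod_tonelli m3 _ mfa) => x; exact: f0.
- by move=> x; exact: integral_ge0.
rewrite pprod_tonelli1//; apply: eq_integral => x _.
by rewrite [RHS]pprod_tonelli1//; exact: measurableT_comp.
Qed.

(** A measurable inverse of a measure-preserving map preserves measure as well. *)
Lemma mpres_assocV : mpres (pprod m1 (pprod m2 m3)) (pprod (pprod m1 m2) m3)
  (fun x => ((x.1, x.2.1), x.2.2)).
Proof.
have [ma aE] := mpres_assoc.
have mv : measurable_fun [set: (T1 * (T2 * T3))%type]
    (fun x => ((x.1, x.2.1), x.2.2)).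
  by do 2 (apply: measurable_fun_pair => //; try exact: measurableT_comp).
split=> // f mf f0.
rewrite -(aE (fun x => f ((x.1, x.2.1), x.2.2)))//.
  by apply: eq_integral => -[[x y] z] _.
exact: measurableT_comp mf mv.
Qed.

End mpres_associativity.

(** Together with [mpres_swap], rebracketing and the identity on a factor, this generates the
    coordinate permutations used below. *)
Lemma mpres_exch {d1 d2 d3} {T1 : measurableType d1} {T2 : measurableType d2}
    {T3 : measurableType d3} (m1 : probability T1 R) (m2 : probability T2 R)
    (m3 : probability T3 R) :
  mpres (pprod m1 (pprod m2 m3)) (pprod m2 (pprod m1 m3))
    (fun x => (x.2.1, (x.1, x.2.2))).
Proof.
exact: (mpres_comp (mpres_assocV m1 m2 m3)
  (mpres_comp (mpres_Xid m3 _ _ _ (mpres_swap m1 m2))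
    (mpres_assoc m2 m1 m3))).
Qed.

End measure_preserving.

Section sample_measure.
Context {R : realType} {d : measure_display} {Z : measurableType d}.
Variable D : probability Z R.
Local Open Scope ereal_scope.

Lemma sample_int_ge0 n (f : n.-tuple Z -> \bar R) :
  (forall S, 0 <= f S) -> 0 <= sample_int D f.
Proof.
elim: n f => [|n IH] f f0; first exact: f0.
by apply: integral_ge0 => z _; exact: IH.
Qed.

(** The law is built by recursion: a Dirac mass at the empty tuple, then the image of D x mu under
    consing. Fubini and the theory of integration thus become available for [sample_int]. *)
Lemma sample_int_measure n : exists mu : probability (n.-tuple Z) R,
  forall f : n.-tuple Z -> \bar R, measurable_fun [set: n.-tuple Z] f ->
    (forall S, 0 <= f S) -> sample_int D f = \int[mu]_S f S.
Proof.
elim: n => [|n [mu IH]].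
  by exists (dirac [tuple]) => f mf f0; rewrite /= integral_dirac// diracT mul1e.
pose c (x : Z * n.-tuple Z) : n.+1.-tuple Z := cons_tuple x.1 x.2.
have mc : measurable_fun setT c by exact: measurable_cons.
pose X : {mfun _ >-> _} := HB.pack c (isMeasurableFun.Build _ _ _ _ c mc).
exists (distribution (pprod D mu) X) => f mf f0 /=.
rewrite ge0_integral_pushforward//= pprod_tonelli1//=; last first.
  exact: (measurableT_comp mf mc).
apply: eq_integral => z _; rewrite IH//.
by apply: measurableT_comp => //; exact: measurable_cons.
Qed.

(** Unlike [replace_at], the swap keeps the displaced example, which makes it an involution that can
    preserve measure. *)
Definition swap_at n (i : 'I_n) (x : n.-tuple Z * Z) : n.-tuple Z * Z :=
  (replace_at x.1 i x.2, tnth x.1 i).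

Lemma replace_at_cons0 n (z0 z : Z) (s : n.-tuple Z) :
  replace_at (cons_tuple z0 s) ord0 z = cons_tuple z s.
Proof.
apply: eq_from_tnth => j; rewrite tnth_mktuple.
by case: (unliftP ord0 j) => [k ->|->] //=; rewrite !tnthS.
Qed.

Lemma replace_at_consS n (z0 z : Z) (s : n.-tuple Z) (i : 'I_n) :
  replace_at (cons_tuple z0 s) (lift ord0 i) z = cons_tuple z0 (replace_at s i z).
Proof.
apply: eq_from_tnth => j; rewrite tnth_mktuple.
case: (unliftP ord0 j) => [k ->|->] //=.
by rewrite !tnthS tnth_mktuple (inj_eq (@lift_inj _ _)).
Qed.

Lemma measurable_swap_at n (i : 'I_n) :
  measurable_fun [set: (n.-tuple Z * Z)%type] (swap_at n i).
Proof.
apply: measurable_fun_pair.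
  apply/measurable_fun_tnthP => j.
  have [ji|ji] := eqVneq j i.
    rewrite [X in measurable_fun _ X](_ : _ = snd)//.
    by apply/funext => x /=; rewrite tnth_mktuple ji eqxx.
  rewrite [X in measurable_fun _ X](_ : _ = (fun x => tnth x.1 j))//.
    by apply: (measurableT_comp (measurable_tnth j)).
  by apply/funext => x /=; rewrite tnth_mktuple (negbTE ji).
exact: (measurableT_comp (measurable_tnth i)).
Qed.

(** For a later index the first example is frozen and induction applies; for the first index the
    swap transposes the two outer factors of D x mu x D. *)
Lemma sample_int_swap n (i : 'I_n) (f : (n.-tuple Z * Z)%type -> \bar R) :
  measurable_fun [set: (n.-tuple Z * Z)%type] f -> (forall x, 0 <= f x) ->
  sample_int D (fun S => \int[D]_z f (swap_at n i (S, z))) =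
  sample_int D (fun S => \int[D]_z f (S, z)).
Proof.
elim: n i f => [[]//|n IH] i f mf f0 /=.
have mc : measurable_fun [set: (Z * n.-tuple Z)%type]
    (fun x => cons_tuple x.1 x.2 : n.+1.-tuple Z) by exact: measurable_cons.
case: (unliftP ord0 i) => [k ->|->].
  apply: eq_integral => z0 _.
  rewrite -(IH k (fun x => f (cons_tuple z0 x.1, x.2)))//; last first.
    apply: measurableT_comp => //; apply: measurable_fun_pair => //.
    by apply: measurable_cons.
  congr sample_int; apply/funext => s; apply: eq_integral => z _.
  by rewrite /swap_at/= replace_at_consS tnthS.
have [mu muE] := sample_int_measure n.
have mg1 : measurable_fun [set: ((Z * n.-tuple Z) * Z)%type]
    (fun x => f (cons_tuple x.1.1 x.1.2, x.2)).
  apply: measurableT_comp => //; apply: measurable_fun_pair => //.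
  by apply: (measurableT_comp mc).
(* The path is ((z0, s), z), (z0, (s, z)), (z0, (z, s)), (z, (z0, s)), (z, (s, z0)), ((z, s),
   z0). *)
have g0 : mpres (pprod (pprod D mu) D) (pprod (pprod D mu) D)
    (fun x => ((x.2, x.1.2), x.1.1)).
  exact: (mpres_comp (mpres_assoc D mu D)
    (mpres_comp (mpres_idX _ _ _ _ (mpres_swap mu D))
    (mpres_comp (mpres_exch D D mu)
    (mpres_comp (mpres_idX _ _ _ _ (mpres_swap D mu))
      (mpres_assocV D mu D))))).
have E g : measurable_fun [set: ((Z * n.-tuple Z) * Z)%type] g ->
    (forall x, 0 <= g x) ->
    \int[D]_z0 sample_int D (fun s => \int[D]_z g ((z0, s), z)) =
    \int[pprod (pprod D mu) D]_x g x.
  move=> mg gg0; rewrite pprod_tonelli1// pprod_tonelli1; last 2 first.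
  - exact: measurable_pprod_tonelli.
  - by move=> x; exact: integral_ge0.
  apply: eq_integral => z0 _; rewrite muE//.
    apply: (measurable_pprod_tonelli D (fun x => g ((z0, x.1), x.2))) => //.
    apply: measurableT_comp => //; apply: measurable_fun_pair => //.
    exact: measurable_fun_pair.
  by move=> s; exact: integral_ge0.
rewrite [RHS](E (fun x => f (cons_tuple x.1.1 x.1.2, x.2)))//.
rewrite -(g0.2 _ mg1)// -(E (fun x => f (cons_tuple x.2 x.1.2, x.1.1)))//.
  apply: eq_integral => z0 _; congr sample_int; apply/funext => s.
  by apply: eq_integral => z _; rewrite /swap_at/= replace_at_cons0.
exact: (measurableT_comp mg1 g0.1).
Qed.

(** Through this exchange invariance the i.i.d. assumption on S enters the stability argument. *)
Lemma sample_measure n : exists mu : probability (n.-tuple Z) R,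
  (forall f : n.-tuple Z -> \bar R, measurable_fun [set: n.-tuple Z] f ->
    (forall S, 0 <= f S) -> sample_int D f = \int[mu]_S f S) /\
  forall i, mpres (pprod mu D) (pprod mu D) (swap_at n i).
Proof.
have [mu muE] := sample_int_measure n; exists mu; split=> // i.
have E g : measurable_fun [set: (n.-tuple Z * Z)%type] g ->
    (forall x, 0 <= g x) ->
    \int[pprod mu D]_x g x = sample_int D (fun S => \int[D]_z g (S, z)).
  move=> mg g0; rewrite pprod_tonelli1// muE//.
    exact: measurable_pprod_tonelli.
  by move=> S; exact: integral_ge0.
have ms := measurable_swap_at n i.
split=> // f mf f0; rewrite E//; last exact: measurableT_comp mf ms.
by rewrite sample_int_swap// -E.
Qed.

End sample_measure.

(** * Bounded measurable functions *)

Section bounded_measurable.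
Context {R : realType} {d : measure_display} {T : measurableType d}.
Implicit Types f g : T -> R.

(** This class is closed under the algebra below and integrable for every probability, so that
    integrability goals reduce to the shape of the integrand. *)
Definition bmf f :=
  measurable_fun [set: T] f /\ exists K : R, forall x, `|f x| <= K.

Lemma bmf_cst (c : R) : bmf (fun=> c).
Proof. by split=> //; exists `|c|. Qed.

Lemma bmfD f g : bmf f -> bmf g -> bmf (fun x => f x + g x).
Proof.
move=> [mf [K fK]] [mg [L gL]]; split; first exact: measurable_funD.
by exists (K + L) => x; rewrite (le_trans (ler_normD _ _))// lerD.
Qed.

Lemma bmfN f : bmf f -> bmf (fun x => - f x).
Proof.
move=> [mf [K fK]]; split; first exact: measurableT_comp.
by exists K => x; rewrite normrN.
Qed.

Lemma bmfM f g : bmf f -> bmf g -> bmf (fun x => f x * g x).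
Proof.
move=> [mf [K fK]] [mg [L gL]]; split; first exact: measurable_funM.
by exists (K * L) => x; rewrite normrM ler_pM.
Qed.

Lemma bmf_norm f : bmf f -> bmf (fun x => `|f x|).
Proof.
move=> [mf [K fK]]; split; first exact: measurableT_comp.
by exists K => x; rewrite normr_id.
Qed.

Lemma bmf_sum (I : Type) (s : seq I) (F : I -> T -> R) :
  (forall i, bmf (F i)) -> bmf (fun x => \sum_(i <- s) F i x).
Proof.
move=> bF; elim: s => [|i s IH].
  under eq_fun do rewrite big_nil; exact: bmf_cst.
by under eq_fun do rewrite big_cons; exact: bmfD.
Qed.

Variable m : probability T R.

Lemma bmf_integrable f : bmf f -> m.-integrable [set: T] (EFin \o f).
Proof.
move=> [mf [K fK]]; apply: measurable_bounded_integrable => //.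
  by rewrite (le_lt_trans (probability_le1 m measurableT))// ltry.
exists K; split; first exact: num_real.
by move=> x Kx y _; exact: le_trans (fK y) (ltW Kx).
Qed.

Lemma bmf_intD f g : bmf f -> bmf g ->
  \int[m]_x (f x + g x) = \int[m]_x f x + \int[m]_x g x.
Proof. by move=> bf bg; rewrite RintegralD//; exact: bmf_integrable. Qed.

Lemma bmf_intB f g : bmf f -> bmf g ->
  \int[m]_x (f x - g x) = \int[m]_x f x - \int[m]_x g x.
Proof. by move=> bf bg; rewrite RintegralB//; exact: bmf_integrable. Qed.

Lemma bmf_intZ (c : R) f : bmf f ->
  \int[m]_x (c * f x) = c * \int[m]_x f x.
Proof. by move=> bf; rewrite RintegralZl//; exact: bmf_integrable. Qed.

Lemma bmf_le f g : bmf f -> bmf g -> (forall x, f x <= g x) ->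
  \int[m]_x f x <= \int[m]_x g x.
Proof.
by move=> bf bg fg; apply: le_Rintegral => //; exact: bmf_integrable.
Qed.

Lemma bmf_int_cst (c : R) : \int[m]_(x in [set: T]) c = c.
Proof.
rewrite Rintegral_cst//; have /= -> := @probability_setT _ _ _ m.
by rewrite mulr1.
Qed.

Lemma bmf_int_sum (I : Type) (s : seq I) (F : I -> T -> R) :
  (forall i, bmf (F i)) ->
  \int[m]_x (\sum_(i <- s) F i x) = \sum_(i <- s) \int[m]_x F i x.
Proof.
move=> bF; elim: s => [|i s IH].
  by under eq_Rintegral do rewrite big_nil; rewrite big_nil bmf_int_cst.
under eq_Rintegral do rewrite big_cons.
by rewrite big_cons bmf_intD ?IH//; exact: bmf_sum.
Qed.

End bounded_measurable.

Lemma bmf_comp {R : realType} {d1 d2} {T1 : measurableType d1}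
    {T2 : measurableType d2} (phi : T1 -> T2) (f : T2 -> R) :
  measurable_fun [set: T1] phi -> bmf f -> bmf (fun x => f (phi x)).
Proof.
move=> mphi [mf [K fK]]; split; first exact: measurableT_comp.
by exists K => x; exact: fK.
Qed.

(** * Replacing one example of a sample *)

Section replace_at_theory.
Context {d : measure_display} {Z : measurableType d} {n : nat}.
Implicit Types (S : n.-tuple Z) (i j : 'I_n).

Lemma tnth_replace_at S i z j :
  tnth (replace_at S i z) j = if j == i then z else tnth S j.
Proof. exact: tnth_mktuple. Qed.

Lemma replace_atK S i z w :
  replace_at (replace_at S i z) i w = replace_at S i w.
Proof.
by apply: eq_from_tnth => k; rewrite !tnth_replace_at; case: eqP.
Qed.

Lemma replace_at_id S i : replace_at S i (tnth S i) = S.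
Proof.
by apply: eq_from_tnth => k; rewrite !tnth_replace_at; case: eqP => [->|].
Qed.

Lemma replace_atC S i j z w : i != j ->
  replace_at (replace_at S i z) j w = replace_at (replace_at S j w) i z.
Proof.
move=> ij; apply: eq_from_tnth => k; rewrite !tnth_replace_at.
by case: (eqVneq k j) => [->|//]; rewrite eq_sym (negbTE ij).
Qed.

Lemma measurable_replace_at {d'} {T : measurableType d'}
    (s : T -> n.-tuple Z) i (z : T -> Z) :
  measurable_fun [set: T] s -> measurable_fun [set: T] z ->
  measurable_fun [set: T] (fun x => replace_at (s x) i (z x)).
Proof.
move=> ms mz.
have mp := measurable_fun_pair ms mz.
exact: (measurableT_comp measurable_fst
  (measurableT_comp (measurable_swap_at n i) mp)).
Qed.

Lemma measurable_tnth_comp {d'} {T : measurableType d'}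
    (s : T -> n.-tuple Z) i :
  measurable_fun [set: T] s -> measurable_fun [set: T] (fun x => tnth (s x) i).
Proof. by move=> ms; exact: (measurableT_comp (measurable_tnth i)). Qed.

End replace_at_theory.

(** * Stability *)

Section stability.
Context {R : realType} {dZ dT : measure_display}.
Context {Z : measurableType dZ} {Theta : measurableType dT} {n : nat}.
Variables (D : probability Z R) (P : probability Theta R).
Variable mu : probability (n.-tuple Z) R.
Hypothesis mu_swap : forall i, mpres (pprod mu D) (pprod mu D) (swap_at n i).
Variable l : n.-tuple Z -> Theta -> Z -> R.
Variables M beta : R.
Hypothesis lM : forall S th z, 0 <= l S th z <= M.
Hypothesis ml : measurable_fun [set: ((n.-tuple Z * Theta) * Z)%type]
  (fun p => l p.1.1 p.1.2 p.2).
Hypothesis n_gt0 : (0 < n)%N.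

(* A point (S, (z1, (z2, (z3, theta)))) is a sample together with three fresh
   examples: z1 is the replacement example, z2 and z3 are test examples. *)
Let Om := (n.-tuple Z * (Z * (Z * (Z * Theta))))%type.
Let m : probability Om R := pprod mu (pprod D (pprod D (pprod D P))).

Let S_ (w : Om) := w.1.
Let z1 (w : Om) := w.2.1.
Let z2 (w : Om) := w.2.2.1.
Let z3 (w : Om) := w.2.2.2.1.
Let th (w : Om) := w.2.2.2.2.

Let mS : measurable_fun [set: Om] S_.
Proof. exact: measurable_fst. Qed.
Let mz1 : measurable_fun [set: Om] z1.
Proof. by apply: measurableT_comp. Qed.
Let mz2 : measurable_fun [set: Om] z2.
Proof. by do 2 apply: measurableT_comp => //. Qed.
Let mz3 : measurable_fun [set: Om] z3.
Proof. by do 3 apply: measurableT_comp => //. Qed.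
Let mth : measurable_fun [set: Om] th.
Proof. by do 3 apply: measurableT_comp => //. Qed.

(** Three transpositions: [sig i] exchanges z_i with z1, [rho] exchanges z1 with z2, and [tau]
    exchanges z2 with z3. The relabellings below are words in them. *)
Let sig i (w : Om) : Om := (replace_at w.1 i w.2.1, (tnth w.1 i, w.2.2)).
Let rho (w : Om) : Om := (w.1, (w.2.2.1, (w.2.1, w.2.2.2))).
Let tau (w : Om) : Om := (w.1, (w.2.1, (w.2.2.2.1, (w.2.2.1, w.2.2.2.2)))).

Let sigP i : mpres m m (sig i).
Proof.
exact: (mpres_comp (mpres_assocV _ _ _) (mpres_comp
  (mpres_Xid _ _ _ _ (mu_swap i)) (mpres_assoc _ _ _))).
Qed.

Let rhoP : mpres m m rho.
Proof. exact: (mpres_idX _ _ _ _ (mpres_exch _ _ _)). Qed.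

Let tauP : mpres m m tau.
Proof.
exact: (mpres_idX _ _ _ _ (mpres_idX _ _ _ _ (mpres_exch _ _ _))).
Qed.

Lemma bmf_loss {d} {T : measurableType d} (s : T -> n.-tuple Z)
    (t : T -> Theta) (z : T -> Z) :
  measurable_fun [set: T] s -> measurable_fun [set: T] t ->
  measurable_fun [set: T] z -> bmf (fun x => l (s x) (t x) (z x)).
Proof.
move=> ms mt mz; split.
  exact: (measurableT_comp ml
    (measurable_fun_pair (measurable_fun_pair ms mt) mz)).
by exists M => x; have /andP[l0 lm] := lM (s x) (t x) (z x); rewrite ger0_norm.
Qed.

Ltac bmt := repeat first
  [ assumption
  | exact: mS | exact: mz1 | exact: mz2 | exact: mz3 | exact: mth
  | apply: bmf_cst | apply: bmf_norm | apply: bmf_sum; intro | apply: bmf_loss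
  | apply: bmfN | apply: bmfD | apply: bmfM
  | apply: measurable_replace_at | apply: measurable_tnth_comp ].

(** The effect of replacing the i-th example is measured at three kinds of point: at z_i itself
    ([a]), at a fresh point ([F]) and at a training example z_j ([c]). Stability controls [a]
    directly, and the others are reduced to it. *)
Let a i (w : Om) := `|l (S_ w) (th w) (tnth (S_ w) i)
  - l (replace_at (S_ w) i (z1 w)) (th w) (tnth (S_ w) i)|.
Let F i (w : Om) := `|l (S_ w) (th w) (z2 w)
  - l (replace_at (S_ w) i (z1 w)) (th w) (z2 w)|.
Let c i j (w : Om) := `|l (S_ w) (th w) (tnth (S_ w) j)
  - l (replace_at (S_ w) i (z1 w)) (th w) (tnth (S_ w) j)|.

Hypothesis stab : forall i, \int[m]_w a i w <= beta.

Let ba i : bmf (a i). Proof. by rewrite /a; bmt. Qed.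
Let bF i : bmf (F i). Proof. by rewrite /F; bmt. Qed.
Let bc i j : bmf (c i j). Proof. by rewrite /c; bmt. Qed.

Let pres_int phi (f : Om -> R) : mpres m m phi -> bmf f ->
  \int[m]_w f (phi w) = \int[m]_w f w.
Proof. by move=> h [mf _]; exact: mpres_Rintegral. Qed.

Let pres_bmf phi (f : Om -> R) : mpres m m phi -> bmf f ->
  bmf (fun w => f (phi w)).
Proof. by move=> [mphi _]; exact: bmf_comp. Qed.

(* Both steps of the path S -> S^{i,z2} -> S^{i,z1} are evaluated at the point
   z2 that occurs in one of the two samples, so each costs beta after a
   measure-preserving relabelling. *)
Let F_le i : \int[m]_w F i w <= 2 * beta.
Proof.
have p1 := mpres_comp rhoP (sigP i).
have p2 := mpres_comp p1 rhoP.
(* After [rho] and [sig i] the sample is S^{i,z2}, its i-th example is z2, and the replacement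
   example is the old z_i, which restores S. One more [rho] makes z1 the replacement example. *)
apply: (@le_trans _ _
  (\int[m]_w (a i (sig i (rho w)) + a i (rho (sig i (rho w)))))).
  apply: bmf_le => //.
    by apply: bmfD; [exact: (pres_bmf _ _ p1)|exact: (pres_bmf _ _ p2)].
  move=> [S [z1' [z2' [z3' t]]]].
  rewrite /F /a /sig /rho /S_ /z1 /z2 /th /= replace_atK replace_at_id.
  rewrite !tnth_replace_at eqxx replace_atK.
  apply: le_trans (ler_distD (l (replace_at S i z2') t z2') _ _) _.
  by rewrite distrC lerD.
rewrite bmf_intD; [|exact: (pres_bmf _ _ p1)|exact: (pres_bmf _ _ p2)].
rewrite (pres_int _ _ p1)// (pres_int _ _ p2)//.
by rewrite mulr_natl mulr2n lerD.
Qed.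

(* Here the path is S -> S^{j,z2} -> (S^{i,z1})^{j,z2} -> S^{i,z1}. *)
Let c_le i j : i != j -> \int[m]_w c i j w <= 4 * beta.
Proof.
move=> ij.
have p2 := mpres_comp rhoP (mpres_comp (sigP j) rhoP).
have p3 := mpres_comp (sigP i) rhoP.
(* In the middle term z_j has left the sample and plays the fresh test point, so [F_le] applies; the
   total is beta + 2 beta + beta. *)
apply: (@le_trans _ _ (\int[m]_w (a j (rho w) + F i (rho (sig j (rho w)))
    + a j (rho (sig i w))))).
  apply: bmf_le => //.
    apply: bmfD; last exact: (pres_bmf _ _ p3).
    by apply: bmfD; [exact: (pres_bmf _ _ rhoP)|exact: (pres_bmf _ _ p2)].
  move=> [S [z1' [z2' [z3' t]]]].
  rewrite /F /a /c /sig /rho /S_ /z1 /z2 /th /=.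
  rewrite !tnth_replace_at eq_sym (negbTE ij).
  rewrite [in X in _ <= X](replace_atC _ j i)//; last by rewrite eq_sym.
  apply: le_trans (ler_distD (l (replace_at S j z2') t (tnth S j)) _ _) _.
  rewrite -addrA lerD//.
  apply: le_trans (ler_distD
    (l (replace_at (replace_at S i z1') j z2') t (tnth S j)) _ _) _.
  by rewrite [X in _ + X <= _]distrC lerD.
rewrite !bmf_intD; try first [exact: (pres_bmf _ _ p3)|exact: (pres_bmf _ _ p2)
  |exact: (pres_bmf _ _ rhoP)].
  rewrite (pres_int _ _ rhoP)// (pres_int _ _ p2)// (pres_int _ _ p3)//.
  have := stab j; have := F_le i; lra.
by apply: bmfD; [exact: (pres_bmf _ _ rhoP)|exact: (pres_bmf _ _ p2)].
Qed.

Definition emp_loss S t := n%:R^-1 * \sum_(i < n) l S t (tnth S i).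
(** A version of the gap with one test point: its mean over a fresh z is Phi(S,theta), and a product
    of two at independent points has mean Phi(S,theta)^2. *)
Definition loss_gap S t z := l S t z - emp_loss S t.

Hypothesis M_ge0 : 0 <= M.

Lemma emp_lossM S t : 0 <= emp_loss S t <= M.
Proof.
have n0 : 0 < n%:R :> R by rewrite ltr0n.
apply/andP; split.
  rewrite mulr_ge0 ?invr_ge0 ?ler0n// sumr_ge0// => i _.
  by case/andP: (lM S t (tnth S i)).
rewrite /emp_loss mulrC ler_pdivrMr// mulr_natr.
apply: le_trans (_ : \sum_(i < n) M <= _); last first.
  by rewrite sumr_const card_ord.
by apply: ler_sum => i _; case/andP: (lM S t (tnth S i)).
Qed.

Lemma loss_gapM S t z : `|loss_gap S t z| <= M.
Proof.
have /andP[h1 h2] := emp_lossM S t; have /andP[h3 h4] := lM S t z.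
by rewrite /loss_gap ler_norml; apply/andP; split; lra.
Qed.

Lemma bmf_loss_gap {d} {T : measurableType d} (s : T -> n.-tuple Z)
    (t : T -> Theta) (z : T -> Z) :
  measurable_fun [set: T] s -> measurable_fun [set: T] t ->
  measurable_fun [set: T] z -> bmf (fun x => loss_gap (s x) (t x) (z x)).
Proof.
move=> ms mt mz; rewrite /loss_gap /emp_loss.
by apply: bmfD; [|apply: bmfN]; bmt.
Qed.

(* Exchanging the i-th example with z1 turns it into a fresh example, and
   exchanging z1 with z3 then changes the sign of the integrand. *)
Let replaced_mean0 i :
  \int[m]_w ((l (replace_at (S_ w) i (z1 w)) (th w) (z3 w)
    - l (replace_at (S_ w) i (z1 w)) (th w) (tnth (S_ w) i))
    * loss_gap (replace_at (S_ w) i (z1 w)) (th w) (z2 w)) = 0.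
Proof.
pose H (w : Om) := (l (S_ w) (th w) (z3 w) - l (S_ w) (th w) (z1 w))
  * loss_gap (S_ w) (th w) (z2 w).
have bH : bmf H by rewrite /H; apply: bmfM; [bmt|exact: bmf_loss_gap].
have p := mpres_comp rhoP (mpres_comp tauP rhoP).
have -> : (\int[m]_w ((l (replace_at (S_ w) i (z1 w)) (th w) (z3 w)
    - l (replace_at (S_ w) i (z1 w)) (th w) (tnth (S_ w) i))
    * loss_gap (replace_at (S_ w) i (z1 w)) (th w) (z2 w)) =
    \int[m]_w H (sig i w)) by [].
rewrite (pres_int _ _ (sigP i))//.
have : \int[m]_w H w = - \int[m]_w H w.
  rewrite -{1}(pres_int _ _ p)// -mulN1r -bmf_intZ//.
  apply: eq_Rintegral => -[S [z1' [z2' [z3' t]]]] _.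
  by rewrite /H /rho /tau /S_ /z1 /z2 /z3 /th /= mulN1r -mulNr opprB.
lra.
Qed.

(** At j = i the two empirical risks use different points, z_i and z1, where stability says nothing;
    the trivial bound M is the source of the term M^2/n. *)
Let d i j (w : Om) := if j == i then M else c i j w.
Let bd i j : bmf (d i j).
Proof. by rewrite /d; case: eqP => _; [exact: bmf_cst|exact: bc]. Qed.

(** With primes for the replaced sample, x y = x' y' + (x - x') y + x' (y - y'), where |y| and |x'|
    are at most M. The change of x is paid at z3 and z_i, that of y at z2 and at the training
    points. *)
Let swap_bound i (w : Om) :
  (l (S_ w) (th w) (z3 w) - l (S_ w) (th w) (tnth (S_ w) i))
    * loss_gap (S_ w) (th w) (z2 w) <=
  (l (replace_at (S_ w) i (z1 w)) (th w) (z3 w)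
    - l (replace_at (S_ w) i (z1 w)) (th w) (tnth (S_ w) i))
    * loss_gap (replace_at (S_ w) i (z1 w)) (th w) (z2 w)
  + M * ((F i (tau w) + a i w) + (F i w + n%:R^-1 * \sum_(j < n) d i j w)).
Proof.
case: w => [S [z1' [z2' [z3' t]]]].
rewrite /F /a /d /c /tau /S_ /z1 /z2 /z3 /th /=; set S' := replace_at S i z1'.
set x := l S t z3' - _; set y := loss_gap S t z2'.
set x' := l S' t z3' - _; set y' := loss_gap S' t z2'.
have -> : x * y = x' * y' + ((x - x') * y + x' * (y - y')) by ring.
rewrite lerD2l.
have hy : `|y| <= M by exact: loss_gapM.
have hx' : `|x'| <= M.
  have /andP[h1 h2] := lM S' t z3'; have /andP[h3 h4] := lM S' t (tnth S i).
  by rewrite /x' ler_norml; apply/andP; split; lra.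
rewrite [leRHS]mulrDr lerD//.
  apply: le_trans (ler_norm _) _; rewrite normrM mulrC ler_pM//.
  have -> : x - x' =
      (l S t z3' - l S' t z3') - (l S t (tnth S i) - l S' t (tnth S i)).
    by rewrite /x /x'; ring.
  exact: ler_normB.
apply: le_trans (ler_norm _) _; rewrite normrM ler_pM//.
have -> : y - y' = (l S t z2' - l S' t z2') - (emp_loss S t - emp_loss S' t).
  by rewrite /y /y' /loss_gap; ring.
apply: le_trans (ler_normB _ _) _; rewrite lerD2l.
rewrite /emp_loss -mulrBr normrM ger0_norm ?invr_ge0 ?ler0n//.
rewrite ler_wpM2l ?invr_ge0 ?ler0n// -sumrB.
apply: le_trans (ler_norm_sum _ _ _) _; apply: ler_sum => j _.
rewrite tnth_replace_at; case: eqP => // _.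
have /andP[h1 h2] := lM S t (tnth S j); have /andP[h3 h4] := lM S' t z1'.
by rewrite ler_norml; apply/andP; split; lra.
Qed.

Lemma beta_ge0 : 0 <= beta.
Proof.
apply: le_trans (stab (Ordinal n_gt0)).
by apply: Rintegral_ge0 => w _; exact: normr_ge0.
Qed.

(** In the integral of [swap_bound] the replaced product vanishes; the errors cost 2 beta, beta, 2
    beta and M/n + 4 beta, each times M. *)
Let correlation_le i :
  \int[m]_w ((l (S_ w) (th w) (z3 w) - l (S_ w) (th w) (tnth (S_ w) i))
    * loss_gap (S_ w) (th w) (z2 w)) <= M ^+ 2 / n%:R + 9 * M * beta.
Proof.
have bFt : bmf (fun w => F i (tau w)) by exact: (pres_bmf _ _ tauP).
have b1 : bmf (fun w => F i (tau w) + a i w) by exact: bmfD.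
have bs : bmf (fun w => \sum_(j < n) d i j w) by exact: bmf_sum.
have bns : bmf (fun w => n%:R^-1 * \sum_(j < n) d i j w).
  by apply: bmfM => //; exact: bmf_cst.
have b2 : bmf (fun w => F i w + n%:R^-1 * \sum_(j < n) d i j w).
  exact: bmfD.
have b3 : bmf (fun w => (F i (tau w) + a i w)
    + (F i w + n%:R^-1 * \sum_(j < n) d i j w)) by exact: bmfD.
have b4 : bmf (fun w => M * ((F i (tau w) + a i w)
    + (F i w + n%:R^-1 * \sum_(j < n) d i j w))).
  by apply: bmfM => //; exact: bmf_cst.
have b5 : bmf (fun w => (l (replace_at (S_ w) i (z1 w)) (th w) (z3 w)
    - l (replace_at (S_ w) i (z1 w)) (th w) (tnth (S_ w) i))
    * loss_gap (replace_at (S_ w) i (z1 w)) (th w) (z2 w)).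
  apply: bmfM; first by bmt.
  by apply: bmf_loss_gap => //; exact: measurable_replace_at.
have n0 : 0 < n%:R :> R by rewrite ltr0n.
have := bmf_le m _ _ _ (bmfD _ _ b5 b4) (swap_bound i).
rewrite bmf_intD// replaced_mean0 add0r => H.
apply: le_trans (H _) _.
  by apply: bmfM; [bmt|exact: bmf_loss_gap].
rewrite bmf_intZ// !bmf_intD// (pres_int _ _ tauP)// bmf_intZ// bmf_int_sum//.
(* The n - 1 indices other than i are relaxed to n, as beta is nonnegative. *)
have hs : \sum_(j < n) \int[m]_w d i j w <= M + n%:R * (4 * beta).
  rewrite (bigD1 i)//= {1}/d eqxx bmf_int_cst lerD2l.
  apply: (@le_trans _ _ (\sum_(j < n | j != i) 4 * beta)).
    apply: ler_sum => j ji; rewrite /d (negbTE ji).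
    by apply: c_le; rewrite eq_sym.
  apply: (@le_trans _ _ (\sum_(j < n) 4 * beta)).
    rewrite [leRHS](bigD1 i)//= lerDr mulr_ge0//; exact: beta_ge0.
  by rewrite sumr_const card_ord -[leLHS]mulr_natl.
have {}hs : n%:R^-1 * \sum_(j < n) \int[m]_w d i j w <= M / n%:R + 4 * beta.
  rewrite mulrC ler_pdivrMr// mulrDl divfK ?gt_eqF// [X in _ + X]mulrC.
  exact: hs.
have -> : M ^+ 2 / n%:R + 9 * M * beta =
  M * ((2 * beta + beta) + (2 * beta + (M / n%:R + 4 * beta))) by ring.
by rewrite ler_wpM2l// lerD// lerD.
Qed.

(** The first factor is the mean over i of l(S,z3) - l(S,z_i), and [correlation_le] is uniform in
    i. *)
Lemma loss_gap_correlation :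
  \int[m]_w (loss_gap w.1 w.2.2.2.2 w.2.2.2.1 * loss_gap w.1 w.2.2.2.2 w.2.2.1)
  <= M ^+ 2 / n%:R + 9 * M * beta.
Proof.
have n0 : 0 < n%:R :> R by rewrite ltr0n.
pose G i (w : Om) := (l (S_ w) (th w) (z3 w) - l (S_ w) (th w) (tnth (S_ w) i))
    * loss_gap (S_ w) (th w) (z2 w).
have bG i : bmf (G i) by apply: bmfM; [bmt|exact: bmf_loss_gap].
apply: (@le_trans _ _ (\int[m]_w (n%:R^-1 * \sum_(i < n) G i w))).
  rewrite le_eqVlt; apply/orP; left; apply/eqP; apply: eq_Rintegral => w _.
  rewrite -/(S_ w) -/(th w) -/(z3 w) -/(z2 w).
  rewrite {1}/loss_gap /G -mulr_suml mulrA; congr (_ * _).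
  rewrite sumrB sumr_const card_ord mulrBr -[X in _ = n%:R^-1 * X - _]mulr_natr.
  by rewrite mulrCA mulVf ?gt_eqF// mulr1.
rewrite bmf_intZ; last exact: bmf_sum.
rewrite bmf_int_sum// mulrC ler_pdivrMr// mulr_natr.
apply: le_trans (_ : \sum_(i < n) (M ^+ 2 / n%:R + 9 * M * beta) <= _).
  by apply: ler_sum => i _; exact: correlation_le.
by rewrite sumr_const card_ord.
Qed.

End stability.

(** * Real and extended integrals, and Fubini for bounded functions *)

Lemma EFin_Rintegral {R : realType} {d} {T : measurableType d}
    (m : probability T R) (f : T -> R) :
  m.-integrable [set: T] (EFin \o f) ->
  (\int[m]_x f x)%:E = (\int[m]_x (f x)%:E)%E.
Proof. by move=> fi; rewrite fineK//; exact: integrable_fin_num fi. Qed.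

(** An empty space has mass 0, not 1. The points obtained let the range of the loss force M to be
    nonnegative. *)
Lemma probability_inhabited {R : realType} {d} {T : measurableType d}
    (m : probability T R) : exists x : T, True.
Proof.
apply: contrapT => h; have := @probability_setT _ _ _ m.
have -> : [set: T] = set0 by apply/seteqP; split=> x //= _; apply: h; exists x.
by rewrite measure0 => /eqP; rewrite eq_sym onee_eq0.
Qed.

Section bmf_fubini.
Context {R : realType} {d1 d2 : measure_display}.
Context {T1 : measurableType d1} {T2 : measurableType d2}.
Variables (m1 : probability T1 R) (m2 : probability T2 R).
Variable f : (T1 * T2)%type -> R.
Hypothesis bf : bmf f.

Let bfx x : bmf (fun y => f (x, y)).
Proof.
by apply: (bmf_comp (fun y => (x, y))) => //; exact: measurable_fun_pair.
Qed.

Let FE : fubini_F m2 (EFin \o f) = EFin \o (fun x => \int[m2]_y f (x, y)).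
Proof.
by apply/funext => x; rewrite /= EFin_Rintegral//; exact: bmf_integrable.
Qed.

Lemma bmf_Fubini : bmf (fun x => \int[m2]_y f (x, y)).
Proof.
split.
  apply/measurable_EFinP; rewrite -FE.
  have := integrable_fubini_F (bmf_integrable (pprod m1 m2) _ bf).
  exact: measurable_int.
have [mf [K fK]] := bf; exists K => x.
apply: le_trans (le_normr_Rintegral _ _) _ => //; first exact: bmf_integrable.
rewrite -[leRHS](bmf_int_cst m2) bmf_le//; last exact: bmf_cst.
exact: bmf_norm.
Qed.

Lemma bmf_int_Fubini :
  \int[pprod m1 m2]_x f x = \int[m1]_x \int[m2]_y f (x, y).
Proof.
have bI := bmf_integrable (pprod m1 m2) _ bf.
apply: EFin_inj; rewrite !EFin_Rintegral//; last first.
  exact: bmf_integrable bmf_Fubini.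
by rewrite -[LHS](fubini1 bI) FE.
Qed.

End bmf_fubini.

(** * The second moment of the gap *)

Section second_moment.
Context {R : realType} {dZ dT : measure_display}.
Context {Z : measurableType dZ} {Theta : measurableType dT} {n : nat}.
Variables (D : probability Z R) (P : probability Theta R).
Variable mu : probability (n.-tuple Z) R.
Hypothesis mu_swap : forall i, mpres (pprod mu D) (pprod mu D) (swap_at n i).
Hypothesis muE : forall f : n.-tuple Z -> \bar R,
  measurable_fun [set: n.-tuple Z] f -> (forall S, 0 <= f S)%E ->
  sample_int D f = (\int[mu]_S f S)%E.
Variable l : n.-tuple Z -> Theta -> Z -> R.
Variables M beta : R.
Hypothesis lM : forall S th z, 0 <= l S th z <= M.
Hypothesis ml : measurable_fun [set: ((n.-tuple Z * Theta) * Z)%type]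
  (fun p => l p.1.1 p.1.2 p.2).
Hypothesis n_gt0 : (0 < n)%N.
Hypothesis M_ge0 : 0 <= M.
Hypothesis stab : forall i : 'I_n,
  (sample_int D (fun S => \int[D]_z \int[P]_theta
    `| (l S theta (tnth S i) - l (replace_at S i z) theta (tnth S i))%:E |)
   <= beta%:E)%E.

Let m := pprod mu (pprod D (pprod D (pprod D P))).

(** The iterated extended integral of the hypothesis becomes one real integral; the test examples z2
    and z3 are projected away. *)
Let stab_int (i : 'I_n) :
  \int[m]_w `|l w.1 w.2.2.2.2 (tnth w.1 i)
    - l (replace_at w.1 i w.2.1) w.2.2.2.2 (tnth w.1 i)| <= beta.
Proof.
pose a (x : (n.-tuple Z * (Z * Theta))%type) := `|l x.1 x.2.2 (tnth x.1 i)
    - l (replace_at x.1 i x.2.1) x.2.2 (tnth x.1 i)|.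
have m1 : measurable_fun [set: (n.-tuple Z * (Z * Theta))%type] fst.
  exact: measurable_fst.
have m2 : measurable_fun [set: (n.-tuple Z * (Z * Theta))%type]
    (fun x => x.2.1) by exact: measurableT_comp.
have m3 : measurable_fun [set: (n.-tuple Z * (Z * Theta))%type]
    (fun x => x.2.2) by exact: measurableT_comp.
have ba : bmf a.
  apply: bmf_norm; apply: bmfD; last apply: bmfN.
    by apply: (bmf_loss l M lM ml) => //; exact: measurable_tnth_comp.
  apply: (bmf_loss l M lM ml) => //; last exact: measurable_tnth_comp.
  exact: measurable_replace_at.
have p : mpres m (pprod mu (pprod D P)) (fun w => (w.1, (w.2.1, w.2.2.2.2))).
  exact: (mpres_idX _ _ _ _ (mpres_idX _ _ _ _
    (mpres_comp (mpres_snd _ _) (mpres_snd _ _)))).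
have maE : measurable_fun [set: (n.-tuple Z * (Z * Theta))%type] (EFin \o a).
  by apply/measurable_EFinP; exact: ba.1.
have a0 x : (0 <= (a x)%:E)%E by rewrite lee_fin; exact: normr_ge0.
have := stab i; rewrite muE; last 2 first.
- apply: (measurable_pprod_tonelli D
    (fun x => \int[P]_t (a (x.1, (x.2, t)))%:E)%E).
    apply: (measurable_pprod_tonelli P (fun x => (a (x.1.1, (x.1.2, x.2)))%:E)).
      exact: (measurableT_comp maE (mpres_assoc mu D P).1).
    by [].
  by move=> x; apply: integral_ge0.
- by move=> S; apply: integral_ge0 => z _; apply: integral_ge0.
rewrite -lee_fin; apply: le_trans.
rewrite (mpres_Rintegral _ _ _ a p ba.1) EFin_Rintegral; last first.
  exact: bmf_integrable.
rewrite pprod_tonelli1//.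
rewrite le_eqVlt; apply/orP; left; apply/eqP; apply: eq_integral => S _.
rewrite pprod_tonelli1//; apply: (measurableT_comp maE).
exact: measurable_fun_pair.
Qed.

Definition mean_gap S t := \int[D]_z loss_gap l S t z.

Lemma bmf_mean_gap :
  bmf (fun x : (n.-tuple Z * Theta)%type => mean_gap x.1 x.2).
Proof.
apply: (bmf_Fubini (pprod mu P) D
  (fun x : ((n.-tuple Z * Theta) * Z)%type => loss_gap l x.1.1 x.1.2 x.2)).
by apply: (bmf_loss_gap l M lM ml) => //; exact: measurableT_comp.
Qed.

(** A squared mean over z is the mean of a product over two independent test points, so the left
    side equals the correlation bounded above. *)
Lemma second_moment_le :
  \int[mu]_S \int[P]_t (mean_gap S t) ^+ 2 <= M ^+ 2 / n%:R + 9 * M * beta.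
Proof.
have b2 : bmf (fun x : (n.-tuple Z * Theta)%type => (mean_gap x.1 x.2) ^+ 2).
  by apply: bmfM; exact: bmf_mean_gap.
rewrite -[leLHS](bmf_int_Fubini mu P (fun x => (mean_gap x.1 x.2) ^+ 2))//.
apply: le_trans (loss_gap_correlation D P mu mu_swap l M beta lM ml n_gt0
  stab_int M_ge0).
pose f (x : ((n.-tuple Z * Theta) * (Z * Z))%type) :=
  loss_gap l x.1.1 x.1.2 x.2.2 * loss_gap l x.1.1 x.1.2 x.2.1.
have bf : bmf f.
  by apply: bmfM; apply: (bmf_loss_gap l M lM ml) => //; exact: measurableT_comp.
(* Here z1 is dropped and the rest regrouped as ((S, theta), (z2, z3)). *)
have p : mpres m (pprod (pprod mu P) (pprod D D))
    (fun w => ((w.1, w.2.2.2.2), (w.2.2.1, w.2.2.2.1))).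
  exact: (mpres_comp (mpres_idX _ _ _ _ (mpres_snd _ _))
   (mpres_comp (mpres_idX _ _ _ _ (mpres_assocV _ _ _))
   (mpres_comp (mpres_idX _ _ _ _ (mpres_swap _ _)) (mpres_assocV _ _ _)))).
rewrite (mpres_Rintegral _ _ _ f p bf.1) [leRHS]bmf_int_Fubini//.
rewrite le_eqVlt; apply/orP; left; apply/eqP; apply: eq_Rintegral => -[S t] _.
have bg : bmf (fun z => loss_gap l S t z) by exact: (bmf_loss_gap l M lM ml).
rewrite (bmf_int_Fubini D D (fun x => loss_gap l S t x.2 * loss_gap l S t x.1)).
  rewrite /= /mean_gap.
  rewrite expr2 -bmf_intZ//; apply: eq_Rintegral => z _.
  by rewrite RintegralZr//; exact: bmf_integrable.
by apply: bmfM; exact: bmf_comp.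
Qed.

End second_moment.

(** * Change of measure *)

Section change_of_measure.
Context {R : realType} {d : measure_display} {T : measurableType d}.

(** The integral of (f - r g)^2 is a quadratic in r that is nonnegative for all r. *)
Lemma Rintegral_cauchy_schwarz (P : probability T R) (f g : T -> R) :
  P.-integrable [set: T] (EFin \o (fun x => f x ^+ 2)) ->
  P.-integrable [set: T] (EFin \o (fun x => g x ^+ 2)) ->
  P.-integrable [set: T] (EFin \o (fun x => f x * g x)) ->
  (\int[P]_x (f x * g x)) ^+ 2 <= (\int[P]_x f x ^+ 2) * (\int[P]_x g x ^+ 2).
Proof.
move=> if2 ig2 ifg; set x := \int[P]_x (f x * g x).
set a := \int[P]_x f x ^+ 2; set k := \int[P]_x g x ^+ 2.
have key (r : R) : 0 <= a - 2 * r * x + r ^+ 2 * k.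
  have -> : a - 2 * r * x + r ^+ 2 * k = \int[P]_y (f y - r * g y) ^+ 2.
    transitivity (\int[P]_y ((f y ^+ 2 - 2 * r * (f y * g y))
        + r ^+ 2 * g y ^+ 2)); last by apply: eq_Rintegral => y _; ring.
    have i1 : P.-integrable [set: T] (EFin \o (fun y => 2 * r * (f y * g y))).
      exact: (integrableZl measurableT (2 * r) ifg).
    have i2 : P.-integrable [set: T] (EFin \o (fun y => r ^+ 2 * g y ^+ 2)).
      exact: (integrableZl measurableT (r ^+ 2) ig2).
    rewrite RintegralD//; last exact: (integrableB measurableT if2 i1).
    by rewrite RintegralB// !RintegralZl.
  by apply: Rintegral_ge0 => y _; exact: sqr_ge0.
have k0 : 0 <= k by apply: Rintegral_ge0 => y _; exact: sqr_ge0.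
have a0 : 0 <= a by apply: Rintegral_ge0 => y _; exact: sqr_ge0.
have [->|x0] := eqVneq x 0; first by rewrite expr0n mulr_ge0.
have [k00|kn0] := eqVneq k 0.
  (* For k = 0 the quadratic is affine in r with nonzero slope; this r gives it the value -1. *)
  have := key ((a + 1) / (2 * x)).
  have -> : a - 2 * ((a + 1) / (2 * x)) * x + ((a + 1) / (2 * x)) ^+ 2 * k = -1.
    by rewrite k00; field.
  by rewrite ler0N1.
have kp : 0 < k by rewrite lt_neqAle eq_sym kn0.
(* This r is the minimiser of the quadratic. *)
have := key (x / k).
have -> : a - 2 * (x / k) * x + (x / k) ^+ 2 * k = a - x ^+ 2 / k by field.
by rewrite subr_ge0 ler_pdivrMr.
Qed.

Variables Q P : probability T R.
Hypothesis QP : Q `<< P.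

Let rn := Radon_Nikodym (charge_of_finite_measure Q) P.
Let g x := fine (rn x).

Let rnE x : rn x = (g x)%:E.
Proof. by rewrite /g fineK//; exact: Radon_Nikodym_fin_num. Qed.

Let rn_int : P.-integrable [set: T] rn.
Proof. exact: Radon_Nikodym_integrable. Qed.

Let mg : measurable_fun [set: T] g.
Proof.
apply/measurable_EFinP; rewrite (_ : _ \o _ = rn); last first.
  by apply/funext => x; rewrite rnE.
exact: measurable_int rn_int.
Qed.

(** The integral of g^2 may be infinite, so the 1 is split off with care: the negative part of g^2 -
    1 is at most 1 and has a finite integral. *)
Lemma chi2D1 : (chi2 Q P + 1 = \int[P]_x (g x ^+ 2)%:E)%E.
Proof.
rewrite /chi2; case: (pselect (Q `<< P)) => // QP_.
pose h x := (g x ^+ 2 - 1)%:E.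
have mh : measurable_fun [set: T] h.
  by apply/measurable_EFinP; apply: measurable_funB => //; exact: measurable_funX.
rewrite (_ : (\int[P]_x _)%E = (\int[P]_x h x)%E); last first.
  by apply: eq_integral => x _; rewrite -/rn rnE.
have mg2 : measurable_fun [set: T] (fun x => (g x ^+ 2)%:E).
  by apply/measurable_EFinP; exact: measurable_funX.
have neg1 : (\int[P]_x (h^\- x) <= 1)%E.
  rewrite -[leRHS](_ : (\int[P]_x cst 1 x)%E = _); last first.
    by rewrite integral_cst// mul1e; exact: probability_setT.
  apply: ge0_le_integral => //; first exact: measurable_funeneg.
  move=> x _; rewrite unlock /= ge_max lee01 andbT /h lee_fin.
  by rewrite opprB lerBlDr lerDl sqr_ge0.
(* Pointwise g^2 + h^- = h^+ + 1 with all terms nonnegative; the finite integral of h^- is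
   subtracted afterwards. *)
have : (\int[P]_x (g x ^+ 2)%:E + \int[P]_x (h^\- x) =
        \int[P]_x (h^\+ x) + 1)%E.
  rewrite -[X in (_ = _ + X)%E](_ : (\int[P]_x cst 1 x)%E = _); last first.
    by rewrite integral_cst// mul1e; exact: probability_setT.
  rewrite -ge0_integralD//; last 2 first.
  - by move=> x _; rewrite lee_fin sqr_ge0.
  - exact: measurable_funeneg.
  rewrite -ge0_integralD//; last exact: measurable_funepos.
  apply: eq_integral => x _; rewrite !unlock /= /h.
  rewrite -!EFin_max -!EFinD; congr (_%:E).
  by rewrite /Order.max; case: ifPn; case: ifPn; lra.
have nf : (\int[P]_x (h^\- x))%E \is a fin_num.
  rewrite ge0_fin_numE; first exact: le_lt_trans neg1 (ltry _).
  exact: integral_ge0.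
move=> /(congr1 (fun x => x - \int[P]_x (h^\- x))%E).
rewrite addeK// => ->; rewrite [X in (X + _)%E]integralE.
by rewrite addeAC.
Qed.

(** The integral of f under Q is that of f g under P, to which Cauchy-Schwarz applies once g is
    square integrable. Otherwise the right side is +oo, because c > 0. *)
Lemma change_of_measure_le (f : T -> R) (c : R) : bmf f -> 0 < c ->
  \int[P]_x f x ^+ 2 <= c ->
  (\int[Q]_x (f x)%:E <= sqrte ((chi2 Q P + 1) * c%:E))%E.
Proof.
move=> bf c0 fc; rewrite chi2D1.
have [mf [K fK]] := bf.
have g20 : (0 <= \int[P]_x (g x ^+ 2)%:E)%E.
  by apply: integral_ge0 => x _; rewrite lee_fin sqr_ge0.
have [->|g2y] := eqVneq (\int[P]_x (g x ^+ 2)%:E)%E +oo%E.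
  by rewrite gt0_mulye ?lte_fin//= leey.
have ig2 : P.-integrable [set: T] (EFin \o (fun x => g x ^+ 2)).
  apply/integrableP; split.
    by apply/measurable_EFinP; exact: measurable_funX.
  under eq_integral do rewrite gee0_abs ?lee_fin ?sqr_ge0//.
  by rewrite ltey.
have if2 : P.-integrable [set: T] (EFin \o (fun x => f x ^+ 2)).
  by apply: bmf_integrable; exact: bmfM.
have fbd : [bounded f x | x in [set: T]].
  exists K; split; first exact: num_real.
  by move=> y Ky x _; exact: le_trans (fK x) (ltW Ky).
have ifg : P.-integrable [set: T] (EFin \o (fun x => f x * g x)).
  have := integrableMr measurableT mf fbd rn_int.
  by apply: eq_integrable => // x _; rewrite /= rnE.
rewrite -(Radon_Nikodym_change_of_variables QP)//; last exact: bmf_integrable.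
rewrite [leLHS](_ : _ = (\int[P]_x (f x * g x)%:E)%E); last first.
  by apply: eq_integral => x _; rewrite EFinM -rnE.
rewrite -!EFin_Rintegral// -EFinM /= lee_fin.
have k0 : 0 <= \int[P]_x g x ^+ 2 by apply: Rintegral_ge0 => x _; exact: sqr_ge0.
apply: le_trans (ler_norm _) _; rewrite -sqrtr_sqr ler_sqrt; last first.
  by rewrite mulr_ge0// ltW.
apply: le_trans (Rintegral_cauchy_schwarz _ _ _ if2 ig2 ifg) _.
by rewrite mulrC ler_wpM2l.
Qed.

End change_of_measure.

(** * The bound with high probability, for all posteriors at once *)

Theorem theorem1
  (dX dY dT : measure_display) (R : realType)
  (X : measurableType dX) (Y : measurableType dY)
  (Theta : measurableType dT) (H : Type)
  (D : probability (X * Y)%type R) (P : probability Theta R)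
  (loss : H -> (X * Y)%type -> R) (M beta : R) (n : nat)
  (A : n.-tuple (X * Y)%type -> Theta -> H) (delta : R) :
  (forall h z, 0 <= loss h z <= M) ->
  measurable_fun [set: (n.-tuple (X * Y)%type * Theta) * (X * Y)%type]
    (fun p => loss (A p.1.1 p.1.2) p.2) ->
  pointwise_hyp_stable D P loss A beta ->
  (1 <= n)%N -> 0 < delta < 1 ->
  exists E : set (n.-tuple (X * Y)%type),
    [/\ measurable E,
        ((1 - delta)%:E <= sample_prob D E)%E &
        forall S, E S -> forall Q : probability Theta R,
          (gen_gap_post D loss A S Q
           <= sqrte ((chi2 Q P + 1) / delta%:E
                     * (2 * M ^+ 2 / n%:R + 12 * M * beta)%:E))%E].
Proof.
move=> lossM ml stab n1 /andP[d0 d1].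
have [mu [muE mu_swap]] := sample_measure D n.
have sprobE E : measurable E -> sample_prob D E = (\int[mu]_S (\1_E S)%:E)%E.
  move=> mE; rewrite /sample_prob muE//.
  by apply/measurable_EFinP; exact: measurable_indic.
have [z0 _] := probability_inhabited D.
have [t0 _] := probability_inhabited P.
have [S0 _] := probability_inhabited mu.
have M0 : 0 <= M by have /andP[] := lossM (A S0 t0) z0; exact: le_trans.
pose l S t z := loss (A S t) z.
have lM S t z : 0 <= l S t z <= M by exact: lossM.
pose gap := mean_gap D l.
have bgap : bmf (fun x : (n.-tuple (X * Y) * Theta)%type => gap x.1 x.2).
exact: (bmf_mean_gap D P mu l M lM ml).
have bgapS S : bmf (gap S).
  by apply: (bmf_comp (fun t => (S, t)) _ _ bgap); exact: measurable_fun_pair.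
have gapE S Q : gen_gap_post D loss A S Q = (\int[Q]_t (gap S t)%:E)%E.
  apply: eq_integral => t _; rewrite /gen_gap /risk.
  have bl : bmf (fun z => loss (A S t) z) by exact: (bmf_loss l M lM ml).
  rewrite -EFin_Rintegral; last exact: bmf_integrable.
  rewrite -EFinB /gap /mean_gap /loss_gap bmf_intB//; last exact: bmf_cst.
  by rewrite bmf_int_cst.
(* For M = 0 the factor on the right vanishes, and +oo * 0 = 0 there. *)
have [M00|Mn0] := eqVneq M 0.
  exists setT; split=> //.
    rewrite sprobE// integral_indic// setIT.
    have /= -> := @probability_setT _ _ _ mu.
    by rewrite lee_fin lerBlDr lerDl ltW.
  (* The gap itself has to vanish here: it is the mean of [loss_gap], whose absolute value is at
     most M = 0. *)
  move=> S _ Q; apply: le_trans (sqrte_ge0 _); rewrite gapE integral0_eq// => t _.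
  congr EFin; apply/eqP; rewrite -normr_le0.
  have bg : bmf (loss_gap l S t) by exact: (bmf_loss_gap l M lM ml).
  apply: le_trans (le_normr_Rintegral measurableT (bmf_integrable D _ bg)) _.
  rewrite -[leRHS](bmf_int_cst D); apply: bmf_le.
  - exact: bmf_norm.
  - exact: bmf_cst.
  - by move=> z; rewrite -M00; exact: loss_gapM.
have Mp : 0 < M by rewrite lt_neqAle eq_sym Mn0.
have n0 : 0 < n%:R :> R by rewrite ltr0n.
have beta0 : 0 <= beta.
  rewrite -lee_fin; apply: le_trans (stab (Ordinal n1)).
  apply: sample_int_ge0 => S.
  by do 2 apply: integral_ge0 => *; exact: abse_ge0.
set B := 2 * M ^+ 2 / n%:R + 12 * M * beta.
have Mn : 0 < M ^+ 2 / n%:R by rewrite divr_gt0// exprn_gt0.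
have Mb : 0 <= M * beta by rewrite mulr_ge0.
have B0 : 0 < B by rewrite /B -mulrA -mulrA; lra.
pose V S := \int[P]_t gap S t ^+ 2.
have bV : bmf V.
  by apply: (bmf_Fubini mu P (fun x => gap x.1 x.2 ^+ 2)); exact: bmfM.
(* The constants 1 and 9 of the second moment are relaxed to 2 and 12. *)
have VB : \int[mu]_S V S <= B.
  have := second_moment_le D P mu mu_swap muE l M beta lM ml n1 M0 stab.
  by move=> /le_trans; apply; rewrite /B -!mulrA; lra.
(* The event involves only the prior, hence it serves every Q. *)
pose E := [set S | V S <= B / delta].
have mE : measurable E.
  rewrite -[E]setTI; exact: (measurable_fun_le measurableT bV.1 (measurable_cst _)).
exists E; split=> //.
- have bE : bmf (\1_E : _ -> R).
    split; first exact: measurable_indic.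
    by exists 1 => S; rewrite indicE; case: (_ \in _); rewrite ?normr1 ?normr0.
  rewrite sprobE// -EFin_Rintegral; last exact: bmf_integrable.
  rewrite lee_fin.
  have b1 : bmf (fun S => 1 - \1_E S : R).
    by apply: bmfD; [exact: bmf_cst|exact: bmfN].
  (* Markov's inequality: V is nonnegative on E and exceeds B / delta off E. Dividing by B > 0
     bounds the mass of the complement by delta. *)
  have : \int[mu]_S (B / delta * (1 - \1_E S)) <= \int[mu]_S V S.
    apply: bmf_le => //; first by apply: bmfM => //; exact: bmf_cst.
    move=> S; rewrite indicE; case: (boolP (S \in E)) => SE.
      rewrite subrr mulr0; apply: Rintegral_ge0 => t _; exact: sqr_ge0.
    rewrite subr0 mulr1 ltW// ltNge; apply/negP => h.
    by move: SE; rewrite notin_setE; apply.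
  rewrite bmf_intZ// bmf_intB//; last exact: bmf_cst.
  rewrite bmf_int_cst => h; have {h} := le_trans h VB.
  by rewrite mulrAC ler_pdivrMr// ler_pM2l// => h; lra.
(* Without absolute continuity the divergence is +oo, and so is the right side, since B and 1 /
   delta are positive. *)
- move=> S ES Q; have [QP|nQP] := pselect (Q `<< P); last first.
    rewrite {1}/chi2; case: pselect => //= _.
    rewrite addye// inver gt_eqF// gt0_mulye ?lte_fin ?invr_gt0//.
    by rewrite gt0_mulye ?lte_fin//= leey.
  rewrite gapE inver gt_eqF// -muleA -EFinM mulrC.
  by apply: change_of_measure_le => //; exact: divr_gt0.
Qed.
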